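(* Let $G^\sigma$ be a $4$-regular oriented graph with optimum skew energy. If the underlying graph $G$ contains a triangle, then $G$ is isomorphic either to $G_1$ or to $G_2$, where $G_1$ is the graph on vertices $u_1,u_2,u_3,u_4,v_1,v_2,v_3,v_4$ in which $\{u_1,u_2,u_3,u_4\}$ and $\{v_1,v_2,v_3,v_4\}$ each induce a complete graph $K_4$ and additionally $u_iv_i$ is an edge for $i=1,2,3,4$ (i.e. $G_1=K_4\square K_2$), and $G_2$ is the graph on vertices $u_1,\dots,u_6$ whose non-edges are exactly $u_1u_6$, $u_2u_4$, $u_3u_5$ (i.e. the octahedron $K_{2,2,2}$).
   Context: For a simple undirected graph $G$ on $n$ vertices $v_1,\dots,v_n$, an orientation $\sigma$ yields an oriented graph $G^\sigma$ with skew-adjacency matrix $S(G^\sigma)=[s_{ij}]$, where $s_{ij}=1$, $s_{ji}=-1$ if $\langle v_i,v_j\rangle$ is an arc and $s_{ij}=s_{ji}=0$ otherwise. The skew energy $\mathcal{E}_S(G^\sigma)$ is the sum of the absolute values of the eigenvalues of $S(G^\sigma)$. It is known that $\mathcal{E}_S(G^\sigma)\le n\sqrt{\Delta}$, where $\Delta$ is the maximum degree; $G^\sigma$ is said to have optimum skew energy if $\mathcal{E}_S(G^\sigma)=n\sqrt{\Delta}$ (equivalently, $S(G^\sigma)^TS(G^\sigma)=\Delta I_n$).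
   Formalization: The graph G is additionally assumed connected; otherwise the claim fails, e.g. for two disjoint copies of K_4□K_2, each with an optimum orientation, which is 4-regular with optimum skew energy and a triangle but is neither G_1 nor G_2. *)

(* Defs.v *)
From HB Require Import structures.
From mathcomp Require Import all_boot all_order all_algebra.

Set Implicit Arguments.
Unset Strict Implicit.
Unset Printing Implicit Defensive.

Import Order.TTheory GRing.Theory Num.Theory.
Local Open Scope ring_scope.

Record simple_graph (T : finType) := SimpleGraph {
  adj :> rel T;
  adj_sym : symmetric adj;
  adj_irr : irreflexive adj
}.

Definition degree (T : finType) (G : simple_graph T) (x : T) : nat :=
  #|[set y | G x y]|.

Definition max_degree (T : finType) (G : simple_graph T) : nat :=
  (\max_(x : T) degree G x)%N.

Definition regular (T : finType) (k : nat) (G : simple_graph T) : Prop :=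
  forall x, degree G x = k.

Definition connected (T : finType) (G : simple_graph T) : Prop :=
  forall x y, connect G x y.

(* The three vertices are pairwise distinct since adjacency is irreflexive. *)
Definition contains_triangle (T : finType) (G : simple_graph T) : Prop :=
  exists x y z, [&& G x y, G y z & G z x].

Definition isomorphic (T U : finType)
    (G : simple_graph T) (H : simple_graph U) : Prop :=
  exists2 f : T -> U, bijective f & forall x y, H (f x) (f y) = G x y.

(* sigma x y means that <x, y> is an arc: every edge of G receives exactly one
   of its two directions, and there are no other arcs. *)
Definition orientation (T : finType) (G : simple_graph T) (sigma : rel T) :
    Prop :=
  (forall x y, G x y = sigma x y || sigma y x) /\
  (forall x y, ~~ (sigma x y && sigma y x)).

Definition skew_adjacency (R : pzRingType) (n : nat) (sigma : rel 'I_n) :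
    'M[R]_n :=
  \matrix_(i, j) (if sigma i j then 1 else if sigma j i then - 1 else 0).

(* The eigenvalues with algebraic multiplicity, as the roots of the split
   characteristic polynomial; determined up to order. *)
Definition eigenvalues (C : numClosedFieldType) (n : nat) (A : 'M[C]_n) :
    seq C :=
  sval (closed_field_poly_normal (char_poly A)).

Definition skew_energy (C : numClosedFieldType) (n : nat) (sigma : rel 'I_n) :
    C :=
  \sum_(z <- eigenvalues (skew_adjacency C sigma)) `|z|.

Definition optimum_skew_energy (C : numClosedFieldType) (n : nat)
    (G : simple_graph 'I_n) (sigma : rel 'I_n) : Prop :=
  skew_energy C sigma = n%:R * sqrtC (max_degree G)%:R.

(* u_(i+1) is inl i and v_(i+1) is inr i. *)
Definition G1_adj : rel ('I_4 + 'I_4) := fun x y =>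
  match x, y with
  | inl i, inl j => i != j
  | inr i, inr j => i != j
  | inl i, inr j => i == j
  | inr i, inl j => i == j
  end.

Lemma G1_sym : symmetric G1_adj.
Proof. by move=> [i|i] [j|j]; rewrite /= eq_sym. Qed.

Lemma G1_irr : irreflexive G1_adj.
Proof. by move=> [i|i]; rewrite /= eqxx. Qed.

Definition G1 : simple_graph ('I_4 + 'I_4)%type := SimpleGraph G1_sym G1_irr.

(* u_(i+1) is the ordinal i, so the pairs below are u1u6, u2u4 and u3u5. *)
Definition G2_nonedges : seq (nat * nat) :=
  [:: (0, 5); (1, 3); (2, 4)]%N.

Definition G2_adj : rel 'I_6 := fun i j =>
  [&& i != j, (val i, val j) \notin G2_nonedges
    & (val j, val i) \notin G2_nonedges].

Lemma G2_sym : symmetric G2_adj.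
Proof. by move=> i j; rewrite /G2_adj eq_sym; congr andb; rewrite andbC. Qed.

Lemma G2_irr : irreflexive G2_adj.
Proof. by move=> i; rewrite /G2_adj eqxx. Qed.

Definition G2 : simple_graph 'I_6 := SimpleGraph G2_sym G2_irr.

(* Main.v *)
(* Optimum skew energy is the equality case of Cauchy-Schwarz for the moduli of
   the eigenvalues, so the skew-adjacency matrix satisfies [S S^* = 4 I].  Off
   the diagonal this says that the signs over the common neighbours of two
   distinct vertices cancel, so their number is even.  Hence in the graph
   induced on the neighbourhood of a vertex every degree is 0 or 2; if the
   vertex lies on a triangle, this graph is K3 + K1 or C4.  In the first case
   the vertex lies on a K4 each of whose vertices has one further neighbour, and
   parity makes these four neighbours pairwise adjacent: G = G1.  In the second
   case parity gives the four neighbours a common second neighbour: G = G2. *)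

Require Import Defs.
From mathcomp Require Import all_boot all_order all_algebra.

Set Implicit Arguments.
Unset Strict Implicit.
Unset Printing Implicit Defensive.

Import Order.TTheory GRing.Theory Num.Theory.
Local Open Scope ring_scope.
Local Open Scope sesquilinear_scope.

(** * Eigenvalues of normal matrices and sums of signs *)

Lemma char_poly_conj (F : fieldType) (n : nat) (P A : 'M[F]_n) :
  P \in unitmx -> char_poly (invmx P *m A *m P) = char_poly A.
Proof.
move=> Pu; have PV : map_mx polyC (invmx P) *m map_mx polyC P = 1%:M.
  by rewrite -map_mxM mulVmx // map_mx1.
rewrite /char_poly /char_poly_mx !map_mxM.
have -> : 'X%:M - map_mx polyC (invmx P) *m map_mx polyC A *m map_mx polyC P
   = map_mx polyC (invmx P) *m ('X%:M - map_mx polyC A) *m map_mx polyC P.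
  by rewrite mulmxBr mulmxBl scalar_mxC -(mulmxA 'X%:M) PV mulmx1.
by rewrite !det_mulmx mulrAC -det_mulmx PV det1 mul1r.
Qed.

(** By the spectral theorem [A] is similar to a diagonal matrix, so both lists are the roots of
    [char_poly A]; this passes from [eigenvalues] to a unitary diagonalisation. *)
Lemma perm_eigenvalues_normal (C : numClosedFieldType) (n : nat)
    (A : 'M[C]_n) : A \is normalmx ->
  perm_eq (eigenvalues A) [seq spectral_diag A 0 i | i <- enum 'I_n].
Proof.
move=> /orthomx_spectralP AE; apply: prod_XsubC_eq.
rewrite big_map big_enum /=; transitivity (char_poly A).
  rewrite /eigenvalues; case: closed_field_poly_normal => s /=.
  by rewrite (monicP (char_poly_monic A)) scale1r.
rewrite {1}AE char_poly_conj ?spectral_unit //.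
rewrite char_poly_trig ?diag_mx_is_trig //.
by apply: eq_bigr => i _; rewrite mxE eqxx.
Qed.

(* Equality case of Cauchy-Schwarz: the hypotheses give
   [\sum_z (|z| - r) ^+ 2 = 0] over the eigenvalues [z]. *)
Lemma normal_energy_eq (C : numClosedFieldType) (n : nat) (A : 'M[C]_n)
    (r : C) : A \is normalmx -> 0 <= r ->
  \tr (A *m A ^t*) = n%:R * r ^+ 2 ->
  \sum_(z <- eigenvalues A) `|z| = n%:R * r ->
  A *m A ^t* = (r ^+ 2)%:M.
Proof.
move=> An r0 trE; rewrite (perm_big _ (perm_eigenvalues_normal An)) /=.
rewrite big_map big_enum /= => enE.
have Pu := spectral_unit A; have PV := invmx_unitary (spectral_unitarymx A).
have AE := orthomx_spectralP An.
set P := spectralmx A in Pu PV AE; set d := spectral_diag A in enE AE.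
have AAE : A *m A ^t* =
    invmx P *m diag_mx (\row_j `|d 0 j| ^+ 2) *m P.
  rewrite AE PV !trmx_mul !map_mxM trmxCK -PV !mulmxA mulmxK //.
  rewrite tr_diag_mx map_diag_mx -[_ *m diag_mx d *m _]mulmxA mulmx_diag.
  by congr (_ *m diag_mx _ *m _); apply/rowP=> j; rewrite !mxE normCK.
have sum0 : \sum_j (`|d 0 j| - r) ^+ 2 = 0.
  (* The trace gives the sum of the squared moduli, so the expansion is
     [n r^2 - 2 n r^2 + n r^2]. *)
  move: trE; rewrite AAE mxtrace_mulC mulmxA mulmxV // mul1mx mxtrace_diag.
  under eq_bigr do rewrite mxE.
  move=> trE; under eq_bigr do rewrite sqrrB.
  rewrite big_split sumrB /= trE sumr_const card_ord.
  rewrite sumrMnl -mulr_suml enE -mulrA -expr2 -[r ^+ 2 *+ n]mulr_natl.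
  by rewrite mulr2n opprD addrA subrr add0r addNr.
have dE j : `|d 0 j| = r.
  apply/eqP; rewrite -subr_eq0 -sqrf_eq0; apply/eqP.
  apply: (psumr_eq0P _ sum0) => // i _.
  by rewrite real_exprn_even_ge0 // rpredB ?ger0_real.
have -> : (r ^+ 2)%:M = invmx P *m (r ^+ 2)%:M *m P.
  by rewrite scalar_mxC -mulmxA mulVmx // mulmx1.
rewrite AAE -diag_const_mx; congr (_ *m diag_mx _ *m _).
by apply/rowP=> j; rewrite !mxE dE.
Qed.

(** Since [(-1) ^+ b = 1 - 2 b], the size of [A] is twice the number of negative signs, first in [R]
    and then, in characteristic 0, in the natural numbers. *)
Lemma even_card_of_sum_sign (R : numDomainType) (I : finType) (A : {set I})
    (b : I -> bool) : \sum_(i in A) (-1) ^+ b i = 0 :> R -> ~~ odd #|A|.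
Proof.
move=> sum0; have : #|A|%:R = (\sum_(i in A) b i).*2%:R :> R.
  apply/eqP; rewrite -subr_eq0 -sum0 -mul2n natrM natr_sum mulr_sumr.
  rewrite -sumr_const -sumrB; apply/eqP; apply: eq_bigr => i _.
  case: (b i); rewrite ?mulr0 ?subr0 // mulr1 expr1.
  by rewrite -[2]/(1 + 1) opprD addrA subrr add0r.
by move/eqP; rewrite eqr_nat => /eqP->; rewrite odd_double.
Qed.

(** * Skew-adjacency matrices and parity of common neighbours *)

Section SkewAdjacency.

Variables (C : numClosedFieldType) (n : nat).
Variables (G : simple_graph 'I_n) (sigma : rel 'I_n).
Hypothesis Gsigma : orientation G sigma.

Let S := skew_adjacency C sigma.

Lemma skew_adjacencyE i j :
  S i j = if G i j then (-1) ^+ ~~ sigma i j else 0.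
Proof.
case: Gsigma => GE _; rewrite mxE GE.
by case: (sigma i j) => //=; case: (sigma j i).
Qed.

Lemma skew_adjacency_trC : S ^t* = - S.
Proof.
case: Gsigma => _ asym; apply/matrixP=> i j; rewrite !mxE.
move: (asym i j); case: (sigma i j); case: (sigma j i) => //= _;
  by rewrite ?rmorphN ?rmorph1 ?opprK ?rmorph0 ?oppr0.
Qed.

Lemma skew_adjacency_normal : S \is normalmx.
Proof. by apply/normalmxP; rewrite skew_adjacency_trC mulNmx mulmxN. Qed.

Lemma skew_adjacency_gramE i j :
  (S *m S ^t*) i j =
  \sum_(k in [set k | G i k && G j k]) (-1) ^+ (sigma i k (+) sigma j k).
Proof.
rewrite mxE [RHS]big_mkcond /=; apply: eq_bigr => k _.
rewrite [S ^t* k j]mxE [S^T k j]mxE !skew_adjacencyE inE.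
case: (G i k); last by rewrite mul0r.
case: (G j k); last by rewrite rmorph0 mulr0.
by rewrite rmorph_sign -signr_addb addbN addNb negbK.
Qed.

Lemma optimum_even_common_neighbours (k : nat) : regular k G ->
  optimum_skew_energy C G sigma ->
  forall x y, x != y -> ~~ odd #|[set z | G x z && G y z]|.
Proof.
move=> Gk opt x y xy; have maxE : max_degree G = k.
  apply/eqP; rewrite eqn_leq -{2}(Gk x) (leq_bigmax x) andbT.
  by apply/bigmax_leqP=> z _; rewrite Gk.
move: opt; rewrite /optimum_skew_energy maxE => opt.
(* Each diagonal entry of the Gram matrix sums one [+1] per neighbour, so it is the degree [k]. *)
have trE : \tr (S *m S ^t*) = n%:R * sqrtC k%:R ^+ 2.
  rewrite sqrtCK -[in n%:R](card_ord n) mulr_natl -sumr_const.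
  apply: eq_bigr => i _.
  rewrite skew_adjacency_gramE -(Gk i) /degree -sum1_card.
  rewrite natr_sum; apply: eq_big => [z|z _]; first by rewrite !inE andbb.
  by rewrite addbb.
have := normal_energy_eq skew_adjacency_normal _ trE opt.
rewrite sqrtC_ge0 ler0n => /(_ isT)/matrixP/(_ x y).
rewrite skew_adjacency_gramE mxE (negPf xy) mulr0n.
exact: even_card_of_sum_sign.
Qed.

End SkewAdjacency.

(** * Isomorphisms between regular graphs *)

Lemma adj_neq (T : finType) (G : simple_graph T) x y : G x y -> x != y.
Proof. by apply: contraTneq => ->; rewrite adj_irr. Qed.

(* By regularity the image of such a homomorphism is closed under adjacency. *)
Lemma regular_hom_isomorphic (T U : finType) (G : simple_graph T)
    (H : simple_graph U) (k : nat) (u0 : U) (g : U -> T) :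
  connected G -> regular k G -> regular k H ->
  (forall u v, H u v -> G (g u) (g v)) ->
  (forall u v, u != v -> ~~ H u v -> g u != g v) -> isomorphic G H.
Proof.
move=> Gconn Gk Hk g_hom g_neq.
(* Adjacent vertices have adjacent, hence distinct, images; [g_neq] covers the other pairs. *)
have g_inj : injective g.
  move=> u v; apply: contra_eq => uv.
  have [/g_hom/adj_neq //|] := boolP (H u v).
  exact: g_neq.
have nbrE u : [set y | G (g u) y] = g @: [set v | H u v].
  apply/esym/eqP; rewrite eqEcard card_imset // -/(degree H u) -/(degree G _).
  rewrite Gk Hk leqnn andbT; apply/subsetP=> y /imsetP[v].
  by rewrite inE => /g_hom Guv ->; rewrite inE.
have g_surj y : exists u, g u == y.
  apply/existsP; pose im := [pred y | [exists u, g u == y]].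
  suff im_closed : closed G im.
    have := closed_connect im_closed (Gconn (g u0) y); rewrite !inE => <-.
    by apply/existsP; exists u0.
  apply: intro_closed; first by apply: sym_connect_sym; exact: adj_sym.
  move=> x z Gxz /existsP[u /eqP ux]; apply/existsP.
  have: z \in [set y | G (g u) y] by rewrite inE ux.
  by rewrite nbrE => /imsetP[v _ ->]; exists v.
pose f y := xchoose (g_surj y).
have fK : cancel f g by move=> y; apply/eqP; exact: (xchooseP (g_surj y)).
have gK : cancel g f by move=> u; apply: g_inj; rewrite fK.
exists f => [|x y]; first by exists g.
(* [nbrE] is an equality of sets, so [g] also reflects adjacency. *)
rewrite -{2}(fK x) -{2}(fK y); have /setP/(_ (g (f y))) := nbrE (f x).
by rewrite inE mem_imset // inE => ->.
Qed.

Lemma G1_regular : regular 4 G1.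
Proof.
move=> x; rewrite /degree -sum1_card big_sumType /=.
rewrite !(big_mkcond (fun _ => _ \in _)) /=.
case: x => [] [[|[|[|[|]]]]] //= ?;
by rewrite !big_ord_recl !big_ord0 /= !inE.
Qed.

Lemma G2_regular : regular 4 G2.
Proof.
move=> x; rewrite /degree -sum1_card !(big_mkcond (fun _ => _ \in _)) /=.
by case: x => [[|[|[|[|[|[|]]]]]]] //= ?;
rewrite !big_ord_recl !big_ord0 /= !inE.
Qed.

(** * Local structure of 4-regular graphs with the parity property *)

Section FourRegular.

Variables (T : finType) (G : simple_graph T).
Hypothesis Gconn : connected G.
Hypothesis G4 : regular 4 G.
Hypothesis Geven : forall x y, x != y -> ~~ odd #|[set z | G x z && G y z]|.

Lemma regular4_nbrs x s : uniq s -> size s = 4 -> all (G x) s -> G x =i s.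
Proof.
move=> us s4 /allP Gs; have /eqP E : [set z in s] == [set z | G x z].
  rewrite eqEcard -/(degree G x) G4 cardsE (card_uniqP us) s4 leqnn andbT.
  by apply/subsetP=> z; rewrite !inE => /Gs.
by move=> z; have /setP/(_ z) := E; rewrite !inE => ->.
Qed.

Lemma regular4_extend x s : uniq s -> (size s < 4)%N -> all (G x) s ->
  exists2 y, G x y & uniq (rcons s y).
Proof.
move=> us s4 Gs; suff [y Gxy yN] : exists2 y, G x y & y \notin s.
  by exists y; rewrite ?rcons_uniq ?yN.
apply/exists_inP; apply: contraTT s4; rewrite -leqNgt.
rewrite negb_exists_in => /forall_inP sub.
rewrite -(G4 x) -(card_uniqP us); apply: subset_leq_card.
by apply/subsetP=> z; rewrite inE => /sub; rewrite negbK.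
Qed.

(** The common neighbours of [x] and [y] are those among [a], [b], [c], [d] adjacent to [y]. In this
    form three known adjacencies determine the fourth. *)
Lemma nbrs_parity x a b c d y : uniq [:: a; b; c; d] ->
  all (G x) [:: a; b; c; d] -> x != y ->
  G y a (+) G y b (+) G y c (+) G y d = false.
Proof.
move=> us Gs xy; have Gx := regular4_nbrs us erefl Gs.
have := Geven xy.
have -> : #|[set z | G x z && G y z]| = count (G y) [:: a; b; c; d].
  rewrite -size_filter -(card_uniqP (filter_uniq _ us)) -cardsE.
  by apply: eq_card => z; rewrite !inE mem_filter andbC -[G x z]/(z \in G x) Gx.
by rewrite /= addn0 !oddD !oddb !addbA => /negbTE.
Qed.

(** Each of [a], [b], [c] already has two neighbours in the triangle, so parity excludes an edge to
    [d]. *)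
Lemma K4_outer_nbr x a b c :
  [/\ G x a, G x b, G x c & [/\ G a b, G a c & G b c]] ->
  exists d, [/\ uniq [:: a; b; c; d], all (G x) [:: a; b; c; d],
    G d a = false, G d b = false & G d c = false].
Proof.
case=> xa xb xc [ab ac bc].
have us : uniq [:: a; b; c].
  by rewrite /= !inE negb_or !(adj_neq ab, adj_neq ac, adj_neq bc).
have [//||d xd us4] := @regular4_extend x _ us; first by rewrite /= xa xb xc.
have Gs : all (G x) [:: a; b; c; d] by rewrite /= xa xb xc xd.
have par := nbrs_parity us4 Gs; exists d; split=> //.
- by have := par a (adj_neq xa); rewrite adj_irr ab ac (adj_sym G a d).
- by have := par b (adj_neq xb);
  rewrite adj_irr (adj_sym G b a) ab bc (adj_sym G b d) /=; case: (G d b).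
- by have := par c (adj_neq xc);
  rewrite adj_irr !(adj_sym G c) ac bc /=; case: (G d c).
Qed.

Lemma K4_isomorphic_G1 x a b c :
  [/\ G x a, G x b, G x c & [/\ G a b, G a c & G b c]] -> isomorphic G G1.
Proof.
case=> xa xb xc [ab ac bc].
have [ax bx cx] : [/\ G a x, G b x & G c x] by rewrite !(adj_sym G _ x).
have [ba ca cb] : [/\ G b a, G c a & G c b].
  by rewrite !(adj_sym G _ a) (adj_sym G c b).
have [//|x' [ux Gx x'a x'b x'c]] := @K4_outer_nbr x a b c.
have [//|a' [ua Ga a'x a'b a'c]] := @K4_outer_nbr a x b c.
have [//|b' [ub Gb b'x b'a b'c]] := @K4_outer_nbr b x a c.
have [//|c' [uc Gc c'x c'a c'b]] := @K4_outer_nbr c x a b.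
have [xx' aa' bb' cc'] : [/\ G x x', G a a', G b b' & G c c'].
  by split; [have := Gx|have := Ga|have := Gb|have := Gc]; case/and5P.
have [xNa' bNa' cNa'] : [/\ x != a', b != a' & c != a'].
  by move: ua; rewrite /= !inE !negb_or -!andbA andbT;
    case/and5P=> _ _ -> _ /andP[-> ->].
have [aNx' bNx' cNx'] : [/\ a != x', b != x' & c != x'].
  by move: ux; rewrite /= !inE !negb_or -!andbA andbT;
    case/and5P=> _ _ -> _ /andP[-> ->].
have [xNb' aNb' cNb'] : [/\ x != b', a != b' & c != b'].
  by move: ub; rewrite /= !inE !negb_or -!andbA andbT;
    case/and5P=> _ _ -> _ /andP[-> ->].
have [xNc' aNc' bNc'] : [/\ x != c', a != c' & b != c'].
  by move: uc; rewrite /= !inE !negb_or -!andbA andbT;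
    case/and5P=> _ _ -> _ /andP[-> ->].
have parx := nbrs_parity ux Gx; have para := nbrs_parity ua Ga.
have parb := nbrs_parity ub Gb.
(* Among the neighbours [a], [b], [c], [x'] of [x], the vertex [a'] is adjacent to [a] but not to
   [b] or [c], hence to [x']. The other pairs are alike, and these edges also show that the outer
   neighbours are distinct. *)
have x'a' : G x' a'.
  by have := parx _ xNa';
    rewrite adj_sym aa' a'b a'c (adj_sym G a') /=; case: (G x' a').
have x'b' : G x' b'.
  by have := parx _ xNb';
    rewrite b'a (adj_sym G b') bb' b'c (adj_sym G b') /=; case: (G x' b').
have x'c' : G x' c'.
  by have := parx _ xNc';
    rewrite c'a c'b (adj_sym G c') cc' (adj_sym G c') /=; case: (G x' c').
have a'b' : G a' b'.
  by have := para _ aNb';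
    rewrite b'x (adj_sym G b') bb' b'c (adj_sym G b') /=; case: (G a' b').
have a'c' : G a' c'.
  by have := para _ aNc';
    rewrite c'x c'b (adj_sym G c') cc' (adj_sym G c') /=; case: (G a' c').
have b'c' : G b' c'.
  by have := parb _ bNc';
    rewrite c'x c'a (adj_sym G c') cc' (adj_sym G c') /=; case: (G b' c').
pose g (u : 'I_4 + 'I_4) := match u with
  | inl i => nth x [:: x; a; b; c] i | inr i => nth x [:: x'; a'; b'; c'] i end.
apply: (@regular_hom_isomorphic _ _ G G1 4 (inl ord0) g) => //;
  first exact: G1_regular.
- by move=> [] [[|[|[|[|//]]]] ?] [] [[|[|[|[|//]]]] ?] //= _;
  rewrite // adj_sym.
- by move=> [] [[|[|[|[|//]]]] ?] [] [[|[|[|[|//]]]] ?] //= _ _;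
  rewrite // eq_sym.
Qed.

Lemma wheel_isomorphic_G2 x a b c d : uniq [:: a; b; c; d] ->
  all (G x) [:: a; b; c; d] -> [/\ G a b, G b c, G c d & G a d] ->
  G a c = false -> G b d = false -> isomorphic G G2.
Proof.
move=> us Gx [ab bc cd ad] aNc bNd.
case/and5P: (Gx) => xa xb xc xd _.
have [ba cb dc da] : [/\ G b a, G c b, G d c & G d a].
  by split; rewrite adj_sym.
have [ax bx cx dx] : [/\ G a x, G b x, G c x & G d x].
  by rewrite !(adj_sym G _ x).
have u3 : uniq [:: x; b; d].
  by move: us; rewrite /= !inE !negb_or !(adj_neq xb, adj_neq xd);
    case/and4P=> _ /andP[_ ->].
have [//||y ay u4] := @regular4_extend a _ u3; first by rewrite /= ax ab ad.
(* The fourth neighbour [y] of [a] is the vertex opposite to [x]: parity over the neighbours of [a]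
   joins it to [b], [c] and [d]. *)
have Ga : all (G a) [:: x; b; d; y] by rewrite /= ax ab ad ay.
have par := nbrs_parity u4 Ga.
have aNc' : a != c by move: us; rewrite /= !inE !negb_or => /andP[/and3P[]].
have cy : G c y by have := par c aNc'; rewrite cx cb cd /=; case: (G c y).
have by' : G b y.
  by have := par b (adj_neq ab); rewrite bx adj_irr bNd /=; case: (G b y).
have dy : G d y.
  by have := par d (adj_neq ad);
    rewrite dx adj_irr (adj_sym G d b) bNd /=; case: (G d y).
have [ya yb yc yd] : [/\ G y a, G y b, G y c & G y d] by rewrite !(adj_sym G y).
have bNd' : b != d by move: u3; rewrite /= !inE => /and3P[].
have xNy : x != y by move: u4; rewrite /= !inE !negb_or => /andP[/and3P[]].
(* In this order the non-edges of [G2] are the pairs [x y], [a c] and [b d]. *)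
apply: (@regular_hom_isomorphic _ _ G G2 4 ord0
  (fun i => nth x [:: x; a; b; c; d; y] i)) => //; first exact: G2_regular.
- by move=> [[|[|[|[|[|[|//]]]]]] ?] [[|[|[|[|[|[|//]]]]]] ?].
- by move=> [[|[|[|[|[|[|//]]]]]] ?] [[|[|[|[|[|[|//]]]]]] ?] //= _ _;
  rewrite // eq_sym.
Qed.

Lemma triangle_isomorphic : contains_triangle G ->
  isomorphic G G1 \/ isomorphic G G2.
Proof.
case=> x [a [b /and3P[xa ab bx]]]; have xb : G x b by rewrite adj_sym.
have u2 : uniq [:: a; b] by rewrite /= inE (adj_neq ab).
have [//||c xc u3] := @regular4_extend x _ u2; first by rewrite /= xa xb.
have [//||d xd u4] := @regular4_extend x _ u3; first by rewrite /= xa xb xc.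
have Gx : all (G x) [:: a; b; c; d] by rewrite /= xa xb xc xd.
have par := nbrs_parity u4 Gx.
have := par a (adj_neq xa); have := par b (adj_neq xb).
have := par c (adj_neq xc); have := par d (adj_neq xd).
rewrite !adj_irr (adj_sym G b a) ab (adj_sym G c a) (adj_sym G c b).
rewrite (adj_sym G d a) (adj_sym G d b) (adj_sym G d c) /=.
(* Parity leaves four cases: around [x] there is the 4-cycle [a b c d], the triangle [a b c], the
   4-cycle [a b d c] or the triangle [a b d]. *)
case bc: (G b c); case bd: (G b d); case cd: (G c d);
  case ac: (G a c); case ad: (G a d) => //= _ _ _ _.
- by right; apply: (@wheel_isomorphic_G2 x a b c d).
- by left; apply: (@K4_isomorphic_G1 x a b c).
- right; apply: (@wheel_isomorphic_G2 x a b d c); rewrite ?bc //.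
  + move: u4; rewrite /= !inE !negb_or (eq_sym d c) -!andbA.
    by case/and5P=> -> -> -> -> /and3P[-> ->].
  + by rewrite /= xa xb xc xd.
  + by rewrite ab bd (adj_sym G d).
- by left; apply: (@K4_isomorphic_G1 x a b d).
Qed.

End FourRegular.

Theorem theorem3p1 (C : numClosedFieldType) (n : nat)
    (G : simple_graph 'I_n) (sigma : rel 'I_n)
    (hconn : connected G)
    (hsigma : orientation G sigma)
    (hreg : regular 4 G)
    (hopt : optimum_skew_energy C G sigma)
    (htri : contains_triangle G) :
  isomorphic G G1 \/ isomorphic G G2.
Proof.
apply: triangle_isomorphic => //.
exact: (optimum_even_common_neighbours hsigma hreg hopt).
Qed.
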